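(* Fix $n\in S$. Then, with probability one, the nodal lines $T_n^{-1}(0)$ and $\widehat{T}_n^{-1}(0)$ of $T_n:=\mathrm{Re}(\Theta_n)$ and $\widehat{T}_n:=\mathrm{Im}(\Theta_n)$ have a finite number of isolated intersection points, whose collection coincides with the set $\mathscr{I}_n:=\{x\in\mathbb{T}:\Theta_n(x)=0\}$; moreover, $\mathscr{I}_n$ does not contain any singular point for $\mathbf{T}_n:=(T_n,\widehat{T}_n)$.
   Context: $\mathbb{T}=\mathbb{R}^2/\mathbb{Z}^2$ is the flat torus. $S$ is the set of positive integers $n$ that can be written as $n=a^2+b^2$ with $a,b\in\mathbb{Z}$. For $n\in S$: $\Lambda_n:=\{\lambda\in\mathbb{Z}^2:\|\lambda\|^2=n\}$, $\mathcal{N}_n:=|\Lambda_n|$, $e_\lambda(x):=e^{2\pi i\langle\lambda,x\rangle}$. The complex arithmetic random wave of order $n$ is $$\Theta_n(x):=\frac{1}{\sqrt{\mathcal{N}_n}}\sum_{\lambda\in\Lambda_n}v_\lambda e_\lambda(x),\quad x\in\mathbb{T},$$ where the $v_\lambda$, $\lambda\in\Lambda_n$, are i.i.d. complex Gaussian random variables such that $\mathrm{Re}(v_\lambda)$ and $\mathrm{Im}(v_\lambda)$ are independent real centered Gaussian random variables with variance one. A point $x\in\mathbb{T}$ is singular for $\mathbf{T}_n$ if the Jacobian matrix $\begin{pmatrix}\partial_1T_n(x)&\partial_2T_n(x)\\ \partial_1\widehat{T}_n(x)&\partial_2\widehat{T}_n(x)\end{pmatrix}$ is not invertible. *)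

(* Defs.v *)
From HB Require Import structures.
From mathcomp Require Import all_boot all_order all_algebra.
From mathcomp Require Import finmap complex zify.
From mathcomp Require Import all_classical all_reals all_analysis.

Set Implicit Arguments.
Unset Strict Implicit.
Unset Printing Implicit Defensive.

Import Order.TTheory GRing.Theory Num.Theory.
Import numFieldNormedType.Exports.

Local Open Scope classical_set_scope.
Local Open Scope ring_scope.
Local Open Scope quotient_scope.
Local Open Scope complex_scope.

Section torus.
Context {R : realType}.

Definition int_lattice : {pred 'rV[R]_2} :=
  fun x => [forall j, x ord0 j \is a Num.int].

Lemma int_lattice_zmod_closed : zmod_closed int_lattice.
Proof.
split; first by apply/forallP => j; rewrite mxE rpred0.
move=> x y /forallP xZ /forallP yZ; apply/forallP => j.
by rewrite !mxE rpredB.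
Qed.

HB.instance Definition _ :=
  GRing.isZmodClosed.Build 'rV[R]_2 int_lattice int_lattice_zmod_closed.

Definition torus := quotient_topology (Quotient.quot int_lattice).

HB.instance Definition _ := Topological.on torus.
HB.instance Definition _ := Quotient.on torus.

Lemma torusP (x y : 'rV[R]_2) :
  \pi_torus x = \pi_torus y <-> exists k : 'rV[int]_2, x = y + map_mx intr k.
Proof.
have -> : (\pi_torus x = \pi_torus y) = ((x - y) \in int_lattice).
  apply/propext; split => [xy|].
    by have := Quotient.idealrBE int_lattice x y => ->; apply/eqP.
  by have := Quotient.idealrBE int_lattice x y => -> /eqP.
split => [/forallP xyZ|[k ->]]; last first.
  by apply/forallP => j; rewrite addrAC subrr add0r mxE intr_int.
exists (\row_j Num.floor ((x - y) ord0 j)); apply/rowP => j.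
by have := xyZ j; rewrite !mxE => /floorK ->; rewrite addrC subrK.
Qed.

(* The j-th partial derivative at x of a function on the torus, computed on
   its periodic lift; partial_pi: the chosen lift of x is irrelevant. *)
Definition partial (j : 'I_2) (f : torus -> R) (x : torus) : R :=
  'D_(delta_mx ord0 j) (f \o \pi_torus) (repr x).

Lemma partial_pi (j : 'I_2) (f : torus -> R) (y : 'rV[R]_2) :
  partial j f (\pi_torus y) = 'D_(delta_mx ord0 j) (f \o \pi_torus) y.
Proof.
have /torusP[k reprE] : \pi_torus (repr (\pi_torus y)) = \pi_torus y.
  by rewrite reprK.
have fE z : (f \o \pi_torus) (z + map_mx intr k) = (f \o \pi_torus) z.
  by rewrite /= (torusP (z + map_mx intr k) z).2//; exists k.
have lim_ext (F G : R -> R) : F =1 G -> lim (F @ 0^') = lim (G @ 0^').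
  by move=> /funext ->.
rewrite /partial /derive reprE; apply: lim_ext => h.
by congr (_ *: (_ - _)); rewrite ?fE //= addrA; exact: fE.
Qed.

Definition jacobian_matrix (f g : torus -> R) (x : torus) : 'M[R]_2 :=
  \matrix_(i, j) partial j (if i == ord0 then f else g) x.

Definition singular (f g : torus -> R) (x : torus) : Prop :=
  jacobian_matrix f g x \notin unitmx.

End torus.
Arguments torus : clear implicits.

Section complex_random_variables.
Context {R : realType}.

HB.instance Definition _ := isPointed.Build R[i] 0.

(* Borel sets of C, identified with R * R *)
Definition complex_measurable : set_system R[i] :=
  preimage_set_system setT (fun z => (complex.Re z, complex.Im z))
    (@measurable _ (R * R)%type).

Let complex_sigma_algebra : sigma_algebra setT complex_measurable.
Proof.
apply: sigma_algebra_preimage; split; first exact: measurable0.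
- by move=> A mA; rewrite setTD; exact: measurableC.
- by move=> F mF; exact: bigcup_measurable.
Qed.

Let complex_measurable0 : complex_measurable set0.
Proof. by case: complex_sigma_algebra. Qed.

Let complex_measurableC A : complex_measurable A -> complex_measurable (~` A).
Proof. by case: complex_sigma_algebra => _ + _ => /[apply]; rewrite setTD. Qed.

Let complex_measurable_bigcup (F : (set R[i])^nat) :
  (forall i, complex_measurable (F i)) -> complex_measurable (\bigcup_i F i).
Proof. by case: complex_sigma_algebra => _ _; exact. Qed.

HB.instance Definition _ := isMeasurable.Build default_measure_display R[i]
  complex_measurable0 complex_measurableC complex_measurable_bigcup.

Context {d : measure_display} {Omega : measurableType d}.
Variable P : probability Omega R.

Definition independent_pair {d1 d2 : measure_display}
    {T1 : measurableType d1} {T2 : measurableType d2}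
    (X : Omega -> T1) (Y : Omega -> T2) : Prop :=
  forall A B, measurable A -> measurable B ->
    P ((X @^-1` A) `&` (Y @^-1` B)) = (P (X @^-1` A) * P (Y @^-1` B))%E.

Definition mutually_independent {d' : measure_display} {T : measurableType d'}
    {I : choiceType} (D : set I) (X : I -> Omega -> T) : Prop :=
  forall J : {fset I}, [set` J] `<=` D ->
  forall A : I -> set T, (forall i, i \in J -> measurable (A i)) ->
    P (\bigcap_(i in [set` J]) (X i @^-1` A i)) =
    (\prod_(i <- J) P (X i @^-1` A i))%E.

Definition identically_distributed {d' : measure_display}
    {T : measurableType d'} {I : Type} (D : set I) (X : I -> Omega -> T) : Prop :=
  forall i j, D i -> D j ->
  forall A, measurable A -> P (X i @^-1` A) = P (X j @^-1` A).

Definition standard_gaussian (X : Omega -> R) : Prop :=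
  forall A, measurable A -> P (X @^-1` A) = normal_prob 0 1 A.

Definition complex_gaussian (V : Omega -> R[i]) : Prop :=
  let X := fun w => complex.Re (V w) in let Y := fun w => complex.Im (V w) in
  [/\ standard_gaussian X, standard_gaussian Y & independent_pair X Y].

End complex_random_variables.

Definition two_square_sums : set nat :=
  [set n | (0 < n)%N /\ exists a b : int, n%:Z = a ^+ 2 + b ^+ 2].

Definition Lambda (n : nat) : set 'rV[int]_2 :=
  [set lambda | \sum_j lambda ord0 j ^+ 2 = n%:Z].

Lemma finite_Lambda n : finite_set (Lambda n).
Proof.
pose B := (fun p : 'I_(n.*2.+1) * 'I_(n.*2.+1) =>
  (\row_j (if j == ord0 then (p.1 : nat)%:Z - n%:Z else (p.2 : nat)%:Z - n%:Z))
  : 'rV[int]_2).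
suff sub : Lambda n `<=` range B.
  apply: sub_finite_set sub _.
  by apply: finite_image; exact: finite_finset.
move=> l; rewrite /Lambda /= big_ord_recl big_ord1 => lE.
have coord (j : 'I_2) : (`|l ord0 j| <= n%:Z)%R.
  have le2 : l ord0 j ^+ 2 <= n%:Z.
    rewrite -lE; have := sqr_ge0 (l ord0 ord0).
    have := sqr_ge0 (l ord0 (lift ord0 ord0)).
    have [->|->] : j = ord0 \/ j = lift ord0 ord0; last 2 first.
    - by move=> ? ?; rewrite lerDl.
    - by move=> ? ?; rewrite lerDr.
    by case: j => [[|[|//]] ?]; [left|right]; exact: val_inj.
  nia.
have lt (j : 'I_2) : (absz (l ord0 j + n%:Z)%R < n.*2.+1)%N by have := coord j; lia.
exists (Ordinal (lt ord0), Ordinal (lt (lift ord0 ord0))) => //.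
apply/rowP => j; rewrite mxE /= -[l 0 j]/(l ord0 j); case: ifPn => [/eqP ->|j0].
  by have := coord ord0; lia.
have -> : j = lift ord0 ord0 by case: j j0 => [[|[|//]] ?] // _; exact: val_inj.
by have := coord (lift ord0 ord0); lia.
Qed.

Section random_wave.
Context {R : realType}.

Definition pairing (lambda : 'rV[int]_2) (x : 'rV[R]_2) : R :=
  \sum_j (lambda ord0 j)%:~R * x ord0 j.

Definition cis (t : R) : R[i] := cos t +i* sin t.

Definition e (lambda : 'rV[int]_2) (x : torus R) : R[i] :=
  cis (2 * pi * pairing lambda (repr x)).

Lemma e_pi (lambda : 'rV[int]_2) (y : 'rV[R]_2) :
  e lambda (\pi_(torus R) y) = cis (2 * pi * pairing lambda y).
Proof.
have cisD2pi t (m : int) : cis (t + 2 * pi * m%:~R) = cis t.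
  have cisS s : cis (s + pi *+ 2) = cis s by rewrite /cis cosD2pi sinD2pi.
  have cisDn s p : cis (s + 2 * pi * p%:R) = cis s.
    elim: p s => [|p IHp] s; first by rewrite mulr0 addr0.
    rewrite -[RHS](IHp s) -[RHS]cisS; congr cis.
    by rewrite -(natr1 p) mulrDr mulr1 addrA mulr_natl.
  case: m => p; first exact: cisDn.
  by rewrite NegzE mulrNz mulrN -[LHS](cisDn _ p.+1) subrK.
have /torusP[k reprE] : \pi_(torus R) (repr (\pi_(torus R) y)) = \pi_(torus R) y.
  by rewrite reprK.
rewrite /e reprE -[RHS](cisD2pi _ (\sum_j lambda ord0 j * k ord0 j)).
congr cis; rewrite -mulrDr; congr (_ * _).
rewrite /pairing rmorph_sum -big_split; apply: eq_bigr => j _.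
by rewrite !mxE mulrDr rmorphM.
Qed.

(* a stands for a realisation of the coefficients v_lambda *)
Definition Theta (n : nat) (a : 'rV[int]_2 -> R[i]) (x : torus R) : R[i] :=
  (Num.sqrt (#|` fset_set (Lambda n)|%:R : R))^-1%:C *
  \sum_(lambda \in Lambda n) a lambda * e lambda x.

Definition ReTheta n a (x : torus R) : R := complex.Re (Theta n a x).

Definition ImTheta n a (x : torus R) : R := complex.Im (Theta n a x).

End random_wave.

(* Main.v *)
Require Import Defs.
From HB Require Import structures.
From mathcomp Require Import all_boot all_order all_algebra.
From mathcomp Require Import finmap complex ring lra zify.
From mathcomp Require Import all_classical all_reals all_analysis.
From mathcomp Require Import measurable_realfun.

(** Why the theorem holds.  On the lift to the plane, Theta_n is a finite sum
    F_a(y) = sum_l a_l cis <k_l, y> whose coefficients are the Gaussian variables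
    up to a nonzero constant.  Everything deterministic follows once no zero of
    F_a is degenerate, that is, once the Jacobian determinant (jacdet) vanishes
    at no zero: the linear part then dominates the quadratic Taylor error near a
    zero, so zeros are isolated (punctured_nonzero), and compactness of the
    torus makes them finitely many (nodal_set_of_nondegenerate).

    That almost surely no zero is degenerate is Sard's theorem in equal
    dimensions, made quantitative and combined with independence.  Fix one
    frequency l0 and multiply F_a by the unimodular factor cis (- <k_l0, y>).
    Zeros and their degeneracy are unchanged, and the equation F_a(y) = 0 becomes
    a_l0 = - G(y), where G is a trigonometric polynomial in the other
    coefficients (degenerate_zero_rotate).  So a degenerate zero exists exactly
    when a_l0 is a critical value of - G, and a_l0 has a bounded density and is
    independent of G.

    Conditioning on G and the measurability of its set of critical values are
    avoided by discretising.  Let the points range over a grid of mesh 1/N and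
    the other coefficients over a grid of mesh 1/N^2.  Within one cell, the
    critical values lie at distance O(1/N) from one of them, and at distance
    O(1/N^2) from a line through it, because the differential at that critical
    point has rank at most one.  This strip is covered by O(N) squares of side
    O(1/N^2) (critical_values_cover), each charged by a complex Gaussian variable
    with mass O(1/N^4).  Summing over the O(N^2) cells of points and the O(N)
    squares, while the cells of coefficients are disjoint events independent of
    a_l0, bounds the probability of a degenerate zero in a bounded region by
    O(N^2 * N / N^4) = O(1/N) (degenerate_zero_cover).

    The Taylor estimate behind all of this is elementary, since translating the
    argument multiplies each term by a factor cis t, and cis t = 1 + i t + O(t^2). *)

Set Implicit Arguments.
Unset Strict Implicit.
Unset Printing Implicit Defensive.

Import Order.TTheory GRing.Theory Num.Theory.
Import numFieldNormedType.Exports.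
Import Normc.

Local Open Scope classical_set_scope.
Local Open Scope ring_scope.
Local Open Scope complex_scope.
Local Open Scope quotient_scope.

(** * The modulus of complex numbers and the second-order estimate of cis *)

Section complex_modulus.
Context {R : realType}.
Implicit Types (z w : R[i]) (s t : R).

Lemma normc_ge0 z : 0 <= normc z.
Proof. by case: z => a b; exact: sqrtr_ge0. Qed.

Lemma normc_neq0 z : z != 0 -> normc z != 0.
Proof. by apply: contra_neq => /eq0_normc. Qed.

Lemma normc_triangle z w : normc (z + w) <= normc z + normc w.
Proof. exact: le_normcD. Qed.

Lemma normc_opp z : normc (- z) = normc z.
Proof. exact: (@normcN _ z). Qed.

Lemma ReB z w : complex.Re (z - w) = complex.Re z - complex.Re w.
Proof. by case: z; case: w. Qed.

Lemma ImB z w : complex.Im (z - w) = complex.Im z - complex.Im w.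
Proof. by case: z; case: w. Qed.

Lemma normc_real t : normc t%:C = `|t|.
Proof. by rewrite /normc /= expr0n addr0 sqrtr_sqr. Qed.

Lemma normRe_le z : `|complex.Re z| <= normc z.
Proof.
case: z => a b /=; rewrite -sqrtr_sqr ler_wsqrtr// lerDl; exact: sqr_ge0.
Qed.

Lemma normIm_le z : `|complex.Im z| <= normc z.
Proof.
case: z => a b /=; rewrite -sqrtr_sqr ler_wsqrtr// lerDr; exact: sqr_ge0.
Qed.

Lemma normc_le z : normc z <= `|complex.Re z| + `|complex.Im z|.
Proof.
case: z => a b /=; have ab0 : 0 <= `|a| + `|b| by rewrite addr_ge0.
rewrite -[leRHS]ger0_norm// -sqrtr_sqr ler_wsqrtr//.
rewrite sqrrD !real_normK ?num_real// -addrA lerD2l lerDr.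
by rewrite mulrn_wge0// mulr_ge0.
Qed.

Lemma normc_sum (I : Type) (s : seq I) (F : I -> R[i]) :
  normc (\sum_(i <- s) F i) <= \sum_(i <- s) normc (F i).
Proof.
elim: s => [|i s IHs]; first by rewrite !big_nil normc0.
by rewrite !big_cons (le_trans (normc_triangle _ _))// lerD2l.
Qed.

Lemma mean_value0 (f df : R -> R) (x : R) :
  (forall y : R, is_derive y 1 f (df y)) ->
  exists2 c, `|c| <= `|x| & f x - f 0 = df c * x.
Proof.
move=> fdf; have cf : continuous f.
  move=> y; apply/differentiable_continuous/derivable1_diffP.
  by have [] := fdf y.
have [x0|x0] := leP 0 x.
  have [c] := MVT_segment x0 (fun y _ => fdf y) (continuous_subspaceT cf).
  rewrite in_itv/= subr0 => /andP[c0 cx] ->; exists c => //.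
  by rewrite !ger0_norm.
have [c] := MVT_segment (ltW x0) (fun y _ => fdf y) (continuous_subspaceT cf).
rewrite in_itv/= => /andP[xc c0] E;
exists c; first by rewrite (ler0_norm c0) (ltr0_norm x0) lerN2.
by rewrite -opprB E sub0r mulrN opprK.
Qed.

Lemma norm_sin_le t : `|sin t| <= `|t|.
Proof.
have [c _] := mean_value0 t (fun y => is_derive_sin y).
rewrite sin0 subr0 => ->; rewrite normrM ler_piMl//; exact: cos_max.
Qed.

Lemma norm_cos_sub1_le t : `|cos t - 1| <= t ^+ 2.
Proof.
have [c ct] := mean_value0 t (fun y => is_derive_cos y).
rewrite cos0 => ->; rewrite normrM normrN -real_normK ?num_real// expr2.
by rewrite ler_wpM2r// (le_trans (norm_sin_le c)).
Qed.

(** The exponent 2 instead of 3 is all that a second-order expansion needs, and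
    it makes the estimate valid for every t. *)
Lemma norm_sin_sub_le t : `|sin t - t| <= t ^+ 2.
Proof.
have D (y : R) : is_derive y 1 (fun u => sin u - u) (cos y - 1).
  by apply: is_deriveB.
have [c ct] := mean_value0 t D; rewrite sin0 !subr0 => ->.
rewrite normrM -real_normK ?num_real// expr2 ler_wpM2r//.
have [b _] := mean_value0 c (fun y => is_derive_cos y).
rewrite cos0 => ->; rewrite normrM normrN (le_trans _ ct)// ler_piMl//.
exact: sin_max.
Qed.

Lemma cisD s t : cis (s + t) = cis s * cis t.
Proof.
rewrite /cis cosD sinD; apply/eqP.
by rewrite eq_complex /= addrC eqxx [X in _ == X]addrC eqxx.
Qed.

Lemma normc_cis t : normc (cis t) = 1.
Proof. by rewrite /cis /= cos2Dsin2 sqrtr1. Qed.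

Lemma cis_linear_approx t : normc (cis t - 1 - (0 +i* t)) <= 2 * t ^+ 2.
Proof.
apply: (le_trans (normc_le _)) => /=; rewrite !subr0 mulr_natl mulr2n.
by rewrite lerD ?norm_cos_sub1_le ?norm_sin_sub_le.
Qed.

End complex_modulus.

Section trigonometric_polynomials.
Context {R : realType}.
Implicit Types (k x h y : 'rV[R]_2).

Definition phase k y : R := \sum_j k ord0 j * y ord0 j.

Lemma phaseDr k y h : phase k (y + h) = phase k y + phase k h.
Proof.
by rewrite /phase -big_split; apply: eq_bigr => j _; rewrite mxE mulrDr.
Qed.

Lemma phaseBl k l y : phase (k - l) y = phase k y - phase l y.
Proof.
by rewrite /phase -sumrB; apply: eq_bigr => j _; rewrite !mxE mulrBl.
Qed.

Lemma normr_coord_le h j : `|h ord0 j| <= `|h|.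
Proof.
rewrite [leRHS]/Num.Def.normr/= mx_normrE.
exact: (le_bigmax _ (fun ij : 'I_1 * 'I_2 => `|h ij.1 ij.2|) (ord0, j)).
Qed.

Lemma phase_le k h : `|phase k h| <= 2 * `|k| * `|h|.
Proof.
rewrite /phase big_ord_recl big_ord1 (le_trans (ler_normD _ _))//.
rewrite -mulrA mulr_natl mulr2n !normrM.
by rewrite lerD// ler_pM ?normr_coord_le.
Qed.

Context {I : Type} (s : seq I) (freq : I -> 'rV[R]_2).
Implicit Types (a b : I -> R[i]).

Definition trigpoly a y : R[i] := \sum_(i <- s) a i * cis (phase (freq i) y).

(** Differentiating a term a_i cis <k_i, y> in the direction j multiplies its
    coefficient by i k_ij, so the partial derivatives of a trigonometric
    polynomial are again trigonometric polynomials. *)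
Definition dcoef (j : 'I_2) a i : R[i] := (0 +i* freq i ord0 j) * a i.

Lemma trigpoly_le a y : normc (trigpoly a y) <= \sum_(i <- s) normc (a i).
Proof.
apply: (le_trans (normc_sum _ _)); apply: ler_sum => i _.
by rewrite normcM normc_cis mulr1.
Qed.

Lemma trigpolyB a b y :
  trigpoly a y - trigpoly b y = trigpoly (fun i => a i - b i) y.
Proof. by rewrite /trigpoly -sumrB; apply: eq_bigr => i _; rewrite mulrBl. Qed.

Definition differential a y h : R[i] :=
  \sum_j (h ord0 j)%:C * trigpoly (dcoef j a) y.

Definition taylor_const a := \sum_(i <- s) normc (a i) * (8 * `|freq i| ^+ 2).

Lemma taylor_const_ge0 a : 0 <= taylor_const a.
Proof.
apply: sumr_ge0 => i _; by rewrite mulr_ge0 ?normc_ge0// mulr_ge0.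
Qed.

(** Translation by h multiplies the term of index i by cis <k_i, h>, whose
    expansion to first order has a quadratic error uniform in y. *)
Lemma trigpoly_taylor a y h :
  normc (trigpoly a (y + h) - trigpoly a y - differential a y h) <=
  taylor_const a * `|h| ^+ 2.
Proof.
have -> : trigpoly a (y + h) - trigpoly a y - differential a y h =
  \sum_(i <- s) a i * cis (phase (freq i) y) *
    (cis (phase (freq i) h) - 1 - (0 +i* phase (freq i) h)).
  rewrite /differential; under [X in _ - X]eq_bigr do rewrite /trigpoly mulr_sumr.
  rewrite exchange_big -sumrB -sumrB; apply: eq_bigr => i _ /=.
  rewrite phaseDr cisD /phase !big_ord_recl !big_ord0 /dcoef !addr0.
  set c := cis _; set c' := cis _.
  set u := freq i ord0 _; set u' := freq i ord0 _.
  have -> : 0 +i* (u * h ord0 ord0 + u' * h ord0 (lift ord0 ord0)) =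
    (0 +i* u) * (h ord0 ord0)%:C + (0 +i* u') * (h ord0 (lift ord0 ord0))%:C.
    by simpc.
  ring.
rewrite /taylor_const mulr_suml (le_trans (normc_sum _ _))//.
apply: ler_sum => i _; rewrite !normcM normc_cis mulr1 -!mulrA.
rewrite ler_wpM2l ?normc_ge0//.
apply: (le_trans (cis_linear_approx _)).
rewrite -[_ ^+ 2]real_normK ?num_real//.
have : `|phase (freq i) h| ^+ 2 <= (2 * `|freq i| * `|h|) ^+ 2.
  by rewrite ler_sqr ?nnegrE ?mulr_ge0// phase_le.
rewrite !exprMn; lra.
Qed.

End trigonometric_polynomials.

(** * Degenerate differentials *)

Section jacobian_determinant.
Context {R : realType}.
Implicit Types z w : R[i].

(** The determinant of the real 2x2 matrix whose columns are z and w. *)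
Definition cross z w : R :=
  complex.Re z * complex.Im w - complex.Re w * complex.Im z.

Lemma cross_mull z w u : cross (u * z) (u * w) = normc u ^+ 2 * cross z w.
Proof.
case: z => a b; case: w => c d; case: u => e f; rewrite /cross /=.
rewrite sqr_sqrtr ?addr_ge0 ?sqr_ge0//; ring.
Qed.

(** The columns z and w of a real 2x2 matrix of nonzero determinant cross z w
    give an injective linear map, and this bounds its inverse explicitly when r is
    the larger of |s| and |t|. *)
Lemma cross_lower_bound z w (s t r : R) :
  (r <= `|s|) || (r <= `|t|) ->
  `|cross z w| * r <= normc (s%:C * z + t%:C * w) * (normc z + normc w).
Proof.
move=> rst; set u := _ + _.
(* Cramer's rule *)
have [Ez Ew] : cross z w * s = cross u w /\ cross z w * t = cross z u.
  rewrite /u /cross; case: z {u} => a b; case: w => c d /=.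
  by split; ring.
have B (x y : R[i]) : `|cross x y| <= normc x * normc y.
  rewrite /cross; case: x => a b; case: y => c d /=.
  rewrite -sqrtrM ?addr_ge0 ?sqr_ge0// -sqrtr_sqr ler_wsqrtr// -subr_ge0.
  have -> : (a ^+ 2 + b ^+ 2) * (c ^+ 2 + d ^+ 2) - (a * d - c * b) ^+ 2 =
    (a * c + b * d) ^+ 2 by ring.
  exact: sqr_ge0.
rewrite mulrDr; case/orP: rst => rE.
  rewrite (le_trans (ler_wpM2l (normr_ge0 _) rE))// -normrM Ez.
  rewrite (le_trans (B u w))//.
  by rewrite lerDr mulr_ge0 ?normc_ge0.
rewrite (le_trans (ler_wpM2l (normr_ge0 _) rE))// -normrM Ew.
rewrite (le_trans (B z u))//.
by rewrite mulrC lerDl mulr_ge0 ?normc_ge0.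
Qed.

(** When the determinant vanishes, one row (the real or the imaginary parts) is
    a multiple of the other.  Choosing which row to express through the other
    keeps the factor m bounded by 1, so that estimates do not depend on it. *)
Lemma cross0_collinear z w : cross z w = 0 ->
  exists2 m : R, `|m| <= 1 &
  (complex.Re z = m * complex.Im z /\ complex.Re w = m * complex.Im w) \/
  (complex.Im z = m * complex.Re z /\ complex.Im w = m * complex.Re w).
Proof.
rewrite /cross; case: z => a b; case: w => c d /= /eqP.
rewrite subr_eq0 => /eqP adcb.
have main (p q r t : R) : p != 0 -> `|q| <= `|p| -> p * t = r * q ->
  exists2 m : R, `|m| <= 1 & q = m * p /\ t = m * r.
  move=> p0 qp E; exists (q / p).
    by rewrite normrM normfV ler_pdivrMr ?normr_gt0// mul1r.
  by rewrite mulfVK//; split => //; apply: (mulfI p0); rewrite E; field.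
(* p, q are the entries of a nonzero column: dividing by the larger of the two
   gives a factor of absolute value at most 1. *)
have half (p q r t : R) : (p != 0) || (q != 0) -> p * t = r * q ->
  exists2 m : R, `|m| <= 1 &
    (p = m * q /\ r = m * t) \/ (q = m * p /\ t = m * r).
  move=> pq E; have [qp|/ltW qp] := leP `|q| `|p|.
    have p0 : p != 0.
      apply: contraTneq pq => p0.
      by rewrite p0 eqxx -normr_le0 -(normr0 R) -p0 qp.
    by have [m ? ?] := main _ _ _ _ p0 qp E; exists m => //; right.
  have q0 : q != 0.
    apply: contraTneq pq => q0.
    by rewrite q0 eqxx orbF negbK -normr_le0 -(normr0 R) -q0 qp.
  have E' : q * r = t * p by rewrite mulrC -E mulrC.
  by have [m ? ?] := main _ _ _ _ q0 qp E'; exists m => //; left.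
have [ab0|] := boolP ((a != 0) || (b != 0)); first exact: half.
rewrite negb_or !negbK => /andP[/eqP a0 /eqP b0].
have [cd0|] := boolP ((c != 0) || (d != 0)).
  have E' : c * b = a * d by rewrite a0 b0 mulr0 mul0r.
  have [m m1 H] := half c d a b cd0 E'; exists m => //.
  by case: H => [[? ?]|[? ?]]; [left|right].
rewrite negb_or !negbK => /andP[/eqP c0 /eqP d0].
by exists 0; rewrite ?normr0 ?ler01//; left; rewrite a0 c0 !mul0r.
Qed.

End jacobian_determinant.

Section zeros.
Context {R : realType} {I : eqType} (s : seq I) (freq : I -> 'rV[R]_2).
Implicit Types (a b : I -> R[i]) (x y h : 'rV[R]_2).

Local Notation F := (trigpoly s freq).
Local Notation D j a := (trigpoly s freq (dcoef freq j a)).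
Local Notation dF := (differential s freq).

Definition jacdet a y : R :=
  cross (D ord0 a y) (D (lift ord0 ord0) a y).

Lemma trigpoly_scale (z : R[i]) a y : F (fun i => z * a i) y = z * F a y.
Proof.
by rewrite /trigpoly mulr_sumr; apply: eq_bigr => i _; rewrite mulrA.
Qed.

Lemma jacdet_scale (z : R[i]) a y :
  jacdet (fun i => z * a i) y = normc z ^+ 2 * jacdet a y.
Proof.
rewrite /jacdet -cross_mull -!trigpoly_scale.
have E j : dcoef freq j (fun i => z * a i) = fun i => z * dcoef freq j a i.
  by apply/funext => i; rewrite /dcoef mulrCA.
by rewrite !E.
Qed.

Lemma differentialE a y h : dF a y h =
  (h ord0 ord0)%:C * D ord0 a y +
  (h ord0 (lift ord0 ord0))%:C * D (lift ord0 ord0) a y.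
Proof. by rewrite /differential big_ord_recl big_ord1. Qed.

Lemma differential_le a y h :
  normc (dF a y h) <=
  `|h| * (normc (D ord0 a y) + normc (D (lift ord0 ord0) a y)).
Proof.
rewrite differentialE (le_trans (normc_triangle _ _))//.
rewrite !normcM !normc_real mulrDr.
by rewrite lerD// ler_wpM2r ?normc_ge0 ?normr_coord_le.
Qed.

Lemma norm_coord_attained h :
  (`|h| <= `|h ord0 ord0|) || (`|h| <= `|h ord0 (lift ord0 ord0)|).
Proof.
have [h0|/mx_norm_neq0[[i j] /= ij]] := eqVneq (mx_norm h) 0.
  by apply/orP; left; rewrite [leLHS]h0.
have -> : `|h| = `|h ord0 j| by rewrite [LHS]ij (ord1 i).
case: (unliftP ord0 j) => [j' ->|->]; last by rewrite lexx.
by rewrite (ord1 j') lexx orbT.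
Qed.

(** At a nondegenerate zero the differential is bounded below by a multiple of
    |h|, which the quadratic error cannot compensate for small h; at a point that
    is not a zero, continuity suffices. *)
Lemma punctured_nonzero a y : (F a y = 0 -> jacdet a y != 0) ->
  exists2 r : R, 0 < r & forall h, h != 0 -> `|h| < r -> F a (y + h) != 0.
Proof.
move=> nd; set C := taylor_const s freq a.
set L := normc (D ord0 a y) + normc (D (lift ord0 ord0) a y).
have C0 : 0 <= C by exact: taylor_const_ge0.
have L0 : 0 <= L by rewrite addr_ge0 ?normc_ge0.
have T h := trigpoly_taylor s freq a y h.
have [F0|F0] := eqVneq (F a y) 0.
  have J0 := nd F0.
  have CL : 0 < C * L + 1 by rewrite ltr_wpDl// mulr_ge0.
  exists (`|jacdet a y| / (C * L + 1)); first by rewrite divr_gt0// normr_gt0.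
  move=> h h0; rewrite ltr_pdivlMr// => hJ; apply/eqP => Fh.
  have hp : 0 < `|h| by rewrite normr_gt0.
  have := T h; rewrite Fh F0 subr0 sub0r normc_opp => Th.
  have := cross_lower_bound (D ord0 a y) (D (lift ord0 ord0) a y)
    (norm_coord_attained h).
  rewrite -differentialE -/L -/(jacdet a y) => J.
  have : `|jacdet a y| * `|h| <= C * `|h| ^+ 2 * L.
    by rewrite (le_trans J)// ler_wpM2r.
  move: hJ hp; move: `|h| `|_| => u v hJ u0; nra.
have FC : 0 < normc (F a y) by rewrite lt_def normc_neq0// normc_ge0.
have CL : 0 < C + L + 1 by rewrite ltr_wpDl// addr_ge0.
exists (Num.min 1 (normc (F a y) / (C + L + 1))).
  by rewrite lt_min ltr01 divr_gt0.
move=> h _; rewrite lt_min ltr_pdivlMr// => /andP[h1 hF]; apply/eqP => Fh.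
have : normc (F a y) <= C * `|h| ^+ 2 + `|h| * L.
  have -> : normc (F a y) =
      normc ((F a (y + h) - F a y - dF a y h) + dF a y h).
    by rewrite subrK Fh sub0r normc_opp.
  by rewrite (le_trans (normc_triangle _ _))// lerD ?differential_le.
have : 0 <= `|h| by [].
move: hF h1; move: `|h| (normc (F a y)) => u v hF h1 u0.
have : C * u ^+ 2 <= C * u by rewrite ler_wpM2l// expr2 ler_piMl// ltW.
nra.
Qed.

Lemma derive_of_quadratic_error (f : 'rV[R]_2 -> R) (y v : 'rV[R]_2) (l C : R) :
  (forall t, `|f (y + t *: v) - f y - t * l| <= C * t ^+ 2) -> 'D_v f y = l.
Proof.
move=> fT; apply: cvg_lim => //.
apply/cvgrPdist_le => /= e e0; near=> t.
have t0 : t != 0 by near: t; exact: nbhs_dnbhs_neq.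
rewrite [t *: v + y]addrC.
have -> : l - t^-1 *: (f (y + t *: v) - f y) =
    - (t^-1 * (f (y + t *: v) - f y - t * l)).
  rewrite mulrBr mulKf// opprB; congr (_ - _).
rewrite normrN normrM normfV ler_pdivrMl ?normr_gt0//.
rewrite (le_trans (fT t))// -real_normK ?num_real// expr2 mulrA mulrC.
rewrite ler_wpM2l//.
have tC : `|t| <= e / (`|C| + 1).
  near: t; apply: dnbhs0_le; rewrite divr_gt0// ltr_wpDl//.
move: tC; rewrite ler_pdivlMr ?ltr_wpDl// => tC.
rewrite (le_trans _ tC)// mulrC ler_wpM2l//.
by rewrite (le_trans (ler_norm C))// lerDl.
Unshelve. all: by end_near. Qed.

Lemma differential_partial a y j (t : R) :
  dF a y (t *: delta_mx ord0 j) = t%:C * D j a y.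
Proof.
rewrite /differential (bigD1 j)//= big1 => [|i ij]; rewrite !mxE eqxx/=.
  by rewrite eqxx mulr1 addr0.
by rewrite (negbTE ij) mulr0 mul0r.
Qed.

Lemma norm_partial_error a y j (t : R) :
  normc (F a (y + t *: delta_mx ord0 j) - F a y - t%:C * D j a y) <=
  taylor_const s freq a * `|delta_mx ord0 j : 'rV[R]_2| ^+ 2 * t ^+ 2.
Proof.
rewrite -differential_partial (le_trans (trigpoly_taylor _ _ _ _ _))//.
by rewrite normrZ exprMn real_normK ?num_real// mulrA mulrAC.
Qed.

Lemma derive_Re_trigpoly a y j :
  'D_(delta_mx ord0 j) (fun z => complex.Re (F a z)) y = complex.Re (D j a y).
Proof.
apply: derive_of_quadratic_error => t.
apply: le_trans (norm_partial_error a y j t).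
apply: le_trans (normRe_le _).
case: (F a _) => p q; case: (F a y) => p' q'; case: (D j a y) => p'' q'' /=.
by rewrite mul0r subr0.
Qed.

Lemma derive_Im_trigpoly a y j :
  'D_(delta_mx ord0 j) (fun z => complex.Im (F a z)) y = complex.Im (D j a y).
Proof.
apply: derive_of_quadratic_error => t.
apply: le_trans (norm_partial_error a y j t).
apply: le_trans (normIm_le _).
case: (F a _) => p q; case: (F a y) => p' q'; case: (D j a y) => p'' q'' /=.
by rewrite mul0r addr0.
Qed.

End zeros.

(** * A quantitative form of Sard's theorem in the plane *)

Section grid.
Context {R : realType}.
Implicit Types M L t u : R.

(** The j-th of the half-open intervals of length 1/L that start at - M; being
    half-open makes distinct cells disjoint, hence the cell events disjoint. *)
Definition gridcell M L (j : nat) : set R :=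
  [set t | (j%:R <= (t + M) * L) && ((t + M) * L < j.+1%:R)].

Lemma gridcell_cover M L (m : nat) t : 0 <= L -> 2 * M * L <= m%:R -> `|t| <= M ->
  exists j : 'I_m.+1, gridcell M L j t.
Proof.
move=> L0 ML; rewrite ler_norml => /andP[Mt tM].
have x0 : 0 <= (t + M) * L by rewrite mulr_ge0//; lra.
have /andP[lo hi] := truncn_itv x0.
suff tm : (Num.truncn ((t + M) * L) < m.+1)%N by exists (Ordinal tm); apply/andP.
rewrite ltnS -(ler_nat R) (le_trans lo)// (le_trans _ ML)// ler_wpM2r//; lra.
Qed.

Lemma gridcell_close M L j t u : 0 < L -> gridcell M L j t -> gridcell M L j u ->
  `|t - u| <= L^-1.
Proof.
move=> L0 /andP[t1 t2] /andP[u1 u2].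
rewrite -[leRHS]mul1r ler_pdivlMr// -{1}(gtr0_norm L0) -normrM ler_norml.
move: t2 u2; rewrite -!natr1; lra.
Qed.

Lemma gridcell_inj M L j j' t : gridcell M L j t -> gridcell M L j' t -> j = j'.
Proof.
move=> /andP[t1 t2] /andP[u1 u2].
have : (j < j'.+1)%N by rewrite -(ltr_nat R) (le_lt_trans t1).
have : (j' < j.+1)%N by rewrite -(ltr_nat R) (le_lt_trans u1).
lia.
Qed.

Definition square (c : R * R) (r : R) : set R[i] :=
  [set z | `|complex.Re z - c.1| <= r /\ `|complex.Im z - c.2| <= r].

(** Cut the range of y into 2KN+1 intervals of length 1/N^2.  While y stays in
    one of them, the slope condition |m| <= 1 confines x to an interval of
    comparable length. *)
Lemma strip_cover (K N : nat) (x0 y0 m : R) : (0 < N)%N -> `|m| <= 1 ->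
  exists g : 'I_(2 * K * N).+1 -> R * R, forall x y,
    `|y - y0| <= K%:R / N%:R ->
    `|x - x0 - m * (y - y0)| <= K%:R / N%:R ^+ 2 ->
    exists i, `|x - (g i).1| <= K.+1%:R / N%:R ^+ 2 /\
              `|y - (g i).2| <= K.+1%:R / N%:R ^+ 2.
Proof.
move=> N0 m1; have Np : 0 < N%:R :> R by rewrite ltr0n.
have N2 : 0 < N%:R ^+ 2 :> R by rewrite exprn_gt0.
pose c (j : nat) : R := j%:R / N%:R ^+ 2 - K%:R / N%:R.
exists (fun j => (x0 + m * c j, y0 + c j)) => x y yK xK.
have [||j jy] := @gridcell_cover (K%:R / N%:R) (N%:R ^+ 2) (2 * K * N) _ _ _ yK.
- exact: ltW.
- rewrite le_eqVlt; apply/orP; left; apply/eqP.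
  by rewrite !natrM; field; rewrite gt_eqF.
have tc : `|y - y0 - c j| <= 1 / N%:R ^+ 2.
  rewrite ler_pdivlMr// -{1}(gtr0_norm N2) -normrM.
  have -> : (y - y0 - c j) * N%:R ^+ 2 =
      (y - y0 + K%:R / N%:R) * N%:R ^+ 2 - j%:R.
    by rewrite /c; field; rewrite gt_eqF.
  by move/andP: jy; rewrite ler_norml -natr1; lra.
have K1 : K.+1%:R / N%:R ^+ 2 = K%:R / N%:R ^+ 2 + 1 / N%:R ^+ 2 :> R.
  by rewrite -mulrDl natr1.
exists j; split => /=; rewrite K1.
  have -> : x - (x0 + m * c j) =
      (x - x0 - m * (y - y0)) + m * (y - y0 - c j) by ring.
  rewrite (le_trans (ler_normD _ _))// lerD// normrM (le_trans _ tc)//.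
  by rewrite ler_piMl.
by rewrite opprD addrA (le_trans tc)// lerDr divr_ge0// ltW.
Qed.

End grid.

Section critical_values.
Context {R : realType} {I : eqType} (s : seq I) (freq : I -> 'rV[R]_2).
Implicit Types (a b : I -> R[i]) (x y h : 'rV[R]_2).

Local Notation F := (trigpoly s freq).
Local Notation D j a := (trigpoly s freq (dcoef freq j a)).
Local Notation dF := (differential s freq).

(** A change of size 1/N^2 of the coefficients and of size 1/N of the point moves
    the value by O(1/N), and by O(1/N^2) once the differential is subtracted: this
    is why the coefficients need the finer mesh. *)
Lemma trigpoly_increment (A : R) : 0 <= A ->
  exists K : nat, forall (N : nat) a b x y, (0 < N)%N ->
  (forall i, i \in s -> normc (a i) <= A) ->
  (forall i, i \in s -> normc (b i - a i) <= 2 / N%:R ^+ 2) ->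
  `|y - x| <= 1 / N%:R ->
  2 * normc (F b y - F a x - dF a x (y - x)) <= K%:R / N%:R ^+ 2 /\
  normc (F b y - F a x) <= K%:R / N%:R.
Proof.
move=> A0.
set T := \sum_(i <- s) A * (8 * `|freq i| ^+ 2).
set S := \sum_(i <- s) `|freq i| * A.
set n : R := \sum_(i <- s) 2.
have T0 : 0 <= T by apply: sumr_ge0 => i _; rewrite !mulr_ge0.
have S0 : 0 <= S by apply: sumr_ge0 => i _; rewrite !mulr_ge0.
have n0 : 0 <= n by apply: sumr_ge0.
have K0 : 0 <= 2 * (n + T + S) by rewrite mulr_ge0 ?addr_ge0.
exists (Num.bound (2 * (n + T + S))) => N a b x y N0 aA ab xy.
have KB := ltW (archi_boundP K0).
set K := (Num.bound _)%:R in KB *.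
have Np : 0 < N%:R :> R by rewrite ltr0n.
have N2 : 0 < N%:R ^+ 2 :> R by rewrite exprn_gt0.
have B1 : normc (F b y - F a y) <= n / N%:R ^+ 2.
  rewrite trigpolyB (le_trans (trigpoly_le _ _ _ _))// /n mulr_suml.
  by rewrite big_seq [leRHS]big_seq; apply: ler_sum => i si; exact: ab.
have B2 : normc (F a y - F a x - dF a x (y - x)) <= T / N%:R ^+ 2.
  have := trigpoly_taylor s freq a x (y - x); rewrite [x + _]addrC subrK => H.
  rewrite (le_trans H)// ler_pM ?taylor_const_ge0//.
    rewrite /taylor_const big_seq /T [leRHS]big_seq; apply: ler_sum => i si.
    by rewrite ler_wpM2r ?mulr_ge0// aA.
  by rewrite -exprVn -[N%:R^-1]mul1r ler_sqr ?nnegrE//.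
have B3 : normc (dF a x (y - x)) <= 2 * S / N%:R.
  have DS j : normc (D j a x) <= S.
    rewrite (le_trans (trigpoly_le _ _ _ _))// /S big_seq [leRHS]big_seq.
    apply: ler_sum => i si; rewrite /dcoef normcM ler_pM ?normc_ge0 ?aA//.
    apply: (le_trans (normc_le _)); rewrite /= normr0 add0r.
    exact: normr_coord_le.
  rewrite (le_trans (differential_le _ _ _ _ _))// mulrC ler_pM//.
  - by rewrite addr_ge0 ?normc_ge0.
  - by rewrite mulr_natl mulr2n lerD.
  - by rewrite (le_trans xy)// mul1r.
have E : normc (F b y - F a x - dF a x (y - x)) <= (n + T) / N%:R ^+ 2.
  have -> : F b y - F a x - dF a x (y - x) =
    (F b y - F a y) + (F a y - F a x - dF a x (y - x)) by ring.
  by rewrite (le_trans (normc_triangle _ _))// mulrDl lerD.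
split.
  rewrite (le_trans (ler_wpM2l _ E))// mulrA ler_wpM2r ?invr_ge0 ?(ltW N2)//.
  by rewrite (le_trans _ KB)// ler_wpM2l// lerDl.
rewrite -[F b y - F a x](subrK (dF a x (y - x))).
rewrite (le_trans (normc_triangle _ _))//.
have N12 : (n + T) / N%:R ^+ 2 <= (n + T) / N%:R.
  rewrite ler_wpM2l ?addr_ge0// lef_pV2 ?posrE// expr2 ler_peMl ?ler1n// ltW.
rewrite (le_trans (lerD (le_trans E N12) B3))// -mulrDl.
rewrite ler_wpM2r ?invr_ge0 ?(ltW Np)//.
by rewrite (le_trans _ KB)//; lra.
Qed.

(** One critical point (a, x) in the cell S serves as reference.  Its differential
    satisfies Re = m Im or Im = m Re, so the corresponding combination of the
    increment is of second order for all other elements of the cell.  The family g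
    depends on S only, which is what allows independence to be used. *)
Lemma critical_values_cover (A : R) : 0 <= A ->
  exists K : nat, forall (N : nat) (S : (I -> R[i]) -> 'rV[R]_2 -> Prop),
  (0 < N)%N ->
  (forall a x, S a x -> forall i, i \in s -> normc (a i) <= A) ->
  (forall a b x y, S a x -> S b y ->
    `|y - x| <= 1 / N%:R /\
    forall i, i \in s -> normc (b i - a i) <= 2 / N%:R ^+ 2) ->
  exists g : 'I_(2 * K * N).+1 -> R * R, forall a x, S a x ->
    jacdet s freq a x = 0 ->
    exists j, square (g j) (K.+1%:R / N%:R ^+ 2) (- F a x).
Proof.
move=> A0; have [K KP] := trigpoly_increment A0; exists K => N S N0 SA Sclose.
have [[a [x [Sax J0]]]|none] :=
    pselect (exists a x, S a x /\ jacdet s freq a x = 0); last first.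
  by exists (fun=> (0, 0)) => a x Sax J0; exfalso; apply: none; exists a, x.
have [m m1 col] := cross0_collinear J0.
(* X and Y stand for Re and Im in either order. *)
have key (X Y : R[i] -> R) (u0 := - F a x) :
    (forall z w, X (z - w) = X z - X w) ->
    (forall z w, Y (z - w) = Y z - Y w) ->
    (forall z, X (- z) = - X z) -> (forall z, Y (- z) = - Y z) ->
    (forall z, `|X z| <= normc z) -> (forall z, `|Y z| <= normc z) ->
    (forall h, X (dF a x h) = m * Y (dF a x h)) ->
  exists g : 'I_(2 * K * N).+1 -> R * R, forall b y, S b y ->
    exists j, `|X (- F b y) - (g j).1| <= K.+1%:R / N%:R ^+ 2 /\
              `|Y (- F b y) - (g j).2| <= K.+1%:R / N%:R ^+ 2.
  move=> XB YB XN YN Xn Yn XY.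
  have [g gP] := strip_cover K (X u0) (Y u0) N0 m1.
  exists g => b y Sby; apply: gP.
    have [xy ab] := Sclose _ _ _ _ Sax Sby.
    have [_ H] := KP N a b x y N0 (SA _ _ Sax) ab xy.
    by rewrite -YB /u0 -opprD YN normrN (le_trans (Yn _)).
  have [xy ab] := Sclose _ _ _ _ Sax Sby.
  have [H _] := KP N a b x y N0 (SA _ _ Sax) ab xy.
  set d := dF a x (y - x) in H; set e := _ - d in H.
  have -> : X (- F b y) - X u0 - m * (Y (- F b y) - Y u0) = - (X e - m * Y e).
    by rewrite /u0 /e !XB !YB !XN !YN XY -/d; ring.
  rewrite normrN (le_trans _ H)// (le_trans (ler_normB _ _))//.
  rewrite mulr_natl mulr2n lerD// normrM (le_trans _ (Yn e))// ler_piMl//.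
have ReN (z : R[i]) : complex.Re (- z) = - complex.Re z by case: z.
have ImN (z : R[i]) : complex.Im (- z) = - complex.Im z by case: z.
case: col => [[E0 E1]|[E0 E1]].
  have XY h : complex.Re (dF a x h) = m * complex.Im (dF a x h).
    rewrite differentialE; move: E0 E1.
    by case: (D _ _ _) => p q; case: (D _ _ _) => p' q' /= -> ->; ring.
  have [g gP] := key _ _ (@ReB R) (@ImB R) ReN ImN (@normRe_le R) (@normIm_le R) XY.
  by exists g => b y Sby _; exact: gP.
have XY h : complex.Im (dF a x h) = m * complex.Re (dF a x h).
  rewrite differentialE; move: E0 E1.
  by case: (D _ _ _) => p q; case: (D _ _ _) => p' q' /= -> ->; ring.
have [g gP] := key _ _ (@ImB R) (@ReB R) ImN ReN (@normIm_le R) (@normRe_le R) XY.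
exists (fun j => ((g j).2, (g j).1)) => b y Sby _.
by have [j [? ?]] := gP b y Sby; exists j.
Qed.

End critical_values.

(** * Gaussian masses and union bounds *)

Section prob.
Context {R : realType} {d : measure_display} {Omega : measurableType d}.
Variable P : probability Omega R.

Definition rect (A B : set R) : set R[i] :=
  [set z | A (complex.Re z) /\ B (complex.Im z)].

Lemma measurable_rect A B : measurable A -> measurable B ->
  measurable (rect A B).
Proof.
move=> mA mB; exists (A `*` B); first exact: measurableX.
by rewrite setTI.
Qed.

Lemma squareE (c : R * R) (r : R) : square c r =
  rect [set` `[c.1 - r, c.1 + r]] [set` `[c.2 - r, c.2 + r]].
Proof.
by apply/seteqP; split => z; rewrite /square /rect /= !in_itv /= -!ler_distl.
Qed.

Lemma measurable_square c r : measurable (square c r : set R[i]).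
Proof. by rewrite squareE; apply: measurable_rect; exact: measurable_itv. Qed.

Lemma gridcellE (M L : R) j : 0 < L ->
  gridcell M L j = [set` `[j%:R / L - M, j.+1%:R / L - M[].
Proof.
move=> L0; apply/seteqP; split => t;
by rewrite /gridcell /= in_itv /= lerBlDr ltrBrDr ler_pdivrMr// ltr_pdivlMr.
Qed.

Lemma measurable_gridcell (M L : R) j : 0 < L -> measurable (gridcell M L j).
Proof. by move=> L0; rewrite gridcellE//; exact: measurable_itv. Qed.

Lemma normal_prob_itv_le (a b : R) : a <= b ->
  (normal_prob 0 1 [set` `[a, b]] <= (normal_peak 1 * (b - a))%:E)%E.
Proof.
move=> ab; rewrite /normal_prob.
apply: (@le_trans _ _
    (\int[lebesgue_measure]_(x in `[a, b]) (normal_peak 1 : R)%:E)%E).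
  apply: ge0_le_integral => //.
  - by move=> x _; rewrite lee_fin normal_pdf_ge0.
  - apply/measurable_EFinP; apply: measurable_funTS.
    exact: measurable_normal_pdf.
  - by move=> x _; rewrite lee_fin normal_pdf_ub// oner_eq0.
rewrite integral_cst//= lebesgue_measure_itv/= lte_fin.
case: ltP => [_|_]; rewrite -?EFinD -EFinM// mulr0 lee_fin.
by rewrite mulr_ge0 ?normal_peak_ge0 ?subr_ge0.
Qed.

Lemma complex_gaussian_square_le (V : Omega -> R[i]) (c : R * R) (r : R) :
  0 <= r -> complex_gaussian P V ->
  (P (V @^-1` square c r) <= ((normal_peak 1 * (2 * r)) ^+ 2)%:E)%E.
Proof.
move=> r0 [gX gY ind]; rewrite squareE.
have -> : V @^-1` rect [set` `[c.1 - r, c.1 + r]] [set` `[c.2 - r, c.2 + r]] =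
  ((fun w => complex.Re (V w)) @^-1` [set` `[c.1 - r, c.1 + r]]) `&`
  ((fun w => complex.Im (V w)) @^-1` [set` `[c.2 - r, c.2 + r]]) by [].
rewrite ind; [|exact: measurable_itv|exact: measurable_itv].
have B (t : R) :
    (normal_prob 0 1 [set` `[(t - r)%R, (t + r)%R]] <=
     (normal_peak 1 * (2 * r))%:E)%E.
  have -> : 2 * r = (t + r) - (t - r) by ring.
  by apply: normal_prob_itv_le; lra.
rewrite (gX _ _) ?(gY _ _); [|exact: measurable_itv|exact: measurable_itv].
rewrite expr2 EFinM.
by apply: lee_pmul; [exact: measure_ge0|exact: measure_ge0|exact: B|exact: B].
Qed.

(** The next two bounds play different roles: summing over the disjoint events
    B t below costs nothing, whereas this union bound costs the number of
    events. *)
Lemma union_bound_card (T : finType) (A : T -> set Omega) (q : R) :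
  0 <= q -> (forall t, measurable (A t)) -> (forall t, P (A t) <= q%:E)%E ->
  (P (\bigcup_t A t) <= (#|T|%:R * q)%:E)%E.
Proof.
move=> q0 mA Aq.
have fT : finite_set [set: T] by exact: finite_finset.
have mU : measurable (\bigcup_t A t) by exact: fin_bigcup_measurable.
apply: (le_trans (content_sub_fsum P fT (fun t _ => mA t) mU (fun w h => h))).
rewrite fsbig_finite//=.
apply: (le_trans (lee_sum _ (fun t _ => Aq t))).
rewrite sumEFin lee_fin big_const_seq count_predT iter_addr_0.
rewrite -[leLHS]mulr_natl ler_wpM2r// ler_nat.
by rewrite -(card_uniqP (fset_uniq (fset_set [set: T]))) max_card.
Qed.

Lemma disjoint_mixture_le (T : finType) (A B : T -> set Omega) (q : R) :
  0 <= q -> (forall t, measurable (A t)) -> (forall t, measurable (B t)) ->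
  trivIset setT B ->
  (forall t, P (A t `&` B t) <= q%:E * P (B t))%E ->
  (P (\bigcup_t (A t `&` B t)) <= q%:E)%E.
Proof.
move=> q0 mA mB tB ABq.
have fT : finite_set [set: T] by exact: finite_finset.
have mAB t : measurable (A t `&` B t) by exact: measurableI.
have mU : measurable (\bigcup_t (A t `&` B t)) by exact: fin_bigcup_measurable.
apply: (le_trans (content_sub_fsum P fT (fun t _ => mAB t) mU (fun w h => h))).
apply: (le_trans (lee_fsum fT (fun t _ => ABq t))).
rewrite -ge0_mule_fsumr => [|t]; last exact: measure_ge0.
rewrite -(measure_fin_bigcup P fT tB (fun t _ => mB t)).
rewrite -[leRHS]mule1; apply: lee_wpmul2l; first by rewrite lee_fin.
exact: probability_le1 (fin_bigcup_measurable _ _).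
Qed.

Context {K : choiceType}.

(** Mutual independence is stated through finite products of probabilities; it
    yields independence of one variable from a joint event of the others. *)
Lemma mutually_independent_split (d' : measure_display) (T : measurableType d')
    (L : set K) (X : K -> Omega -> T) (i0 : K) (J : {fset K}) (B : set T)
    (A : K -> set T) :
  mutually_independent P L X -> L i0 -> [set` J] `<=` L -> i0 \notin J ->
  measurable B -> (forall i, i \in J -> measurable (A i)) ->
  P ((X i0 @^-1` B) `&` \bigcap_(i in [set` J]) (X i @^-1` A i)) =
  (P (X i0 @^-1` B) * P (\bigcap_(i in [set` J]) (X i @^-1` A i)))%E.
Proof.
move=> ind Li0 JL i0J mB mA.
pose A' i := if i == i0 then B else A i.
have A'J i : i \in J -> A' i = A i.
  by move=> iJ; rewrite /A' ifN//; apply: contraNneq i0J => <-.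
have -> : (X i0 @^-1` B) `&` \bigcap_(i in [set` J]) (X i @^-1` A i) =
    \bigcap_(i in [set` (i0 |` J)%fset]) (X i @^-1` A' i).
  apply/seteqP; split => w /=.
    move=> [w0 wJ] i /=; rewrite !inE => /orP[/eqP->|iJ]; rewrite /preimage /=.
      by rewrite /A' eqxx.
    by rewrite A'J//; exact: wJ.
  move=> wJ; split.
    by have := wJ i0; rewrite /= !inE eqxx /A' eqxx => /(_ isT).
  move=> i iJ; have := wJ i; rewrite /= !inE iJ orbT /preimage /= A'J//.
  exact.
rewrite ind; last 2 first.
- by move=> i /=; rewrite !inE => /orP[/eqP->//|]; exact: JL.
- move=> i; rewrite !inE => /orP[/eqP->|iJ]; first by rewrite /A' eqxx.
  by rewrite A'J//; exact: mA.
rewrite big_fsetU1//= {1}/A' eqxx; congr (_ * _)%E.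
by rewrite ind//; apply: eq_big_seq => i iJ; rewrite A'J.
Qed.

End prob.

(** * Almost surely no degenerate zero *)

Section coefficient_boxes.
Context {R : realType}.

Definition coefbox (M : nat) (l : R) (b : nat * nat) : set R[i] :=
  rect (gridcell M%:R l b.1) (gridcell M%:R l b.2).

Lemma coefbox_close M (l : R) b z w : 0 < l ->
  coefbox M l b z -> coefbox M l b w -> normc (z - w) <= 2 / l.
Proof.
move=> l0 [zr zi] [wr wi].
have /= := normc_le (z - w); move/le_trans; apply.
rewrite ReB ImB.
rewrite mulr_natl mulr2n lerD//.
  exact: gridcell_close l0 zr wr.
exact: gridcell_close l0 zi wi.
Qed.

Lemma coefbox_inj M (l : R) b b' z : coefbox M l b z -> coefbox M l b' z -> b = b'.
Proof.
move=> [zr zi] [zr' zi']; rewrite [b]surjective_pairing [b']surjective_pairing.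
by rewrite (gridcell_inj zr zr') (gridcell_inj zi zi').
Qed.

Lemma measurable_coefbox M (l : R) b : 0 < l -> measurable (coefbox M l b).
Proof. by move=> l0; apply: measurable_rect; exact: measurable_gridcell. Qed.

End coefficient_boxes.

Section degenerate_zeros.
Context {R : realType} {d : measure_display} {Omega : measurableType d}.
Variable P : probability Omega R.
Context {K : choiceType} (L : set K) (X : K -> {RV P >-> R[i]}).
Hypothesis X_independent :
  mutually_independent P L (fun i => X i : Omega -> R[i]).
Hypothesis X_gaussian : forall i, L i -> complex_gaussian P (X i).
Variables (i0 : K) (J : {fset K}) (freq : K -> 'rV[R]_2).
Hypotheses (Li0 : L i0) (JL : [set` J] `<=` L) (i0J : i0 \notin J).

Local Notation s := (enum_fset J).

(** The truncation at M makes the constants of the covering uniform. *)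
Definition degenerate_zero (M : nat) : set Omega := [set w |
  (forall i, i \in s ->
     `|complex.Re (X i w)| <= M%:R /\ `|complex.Im (X i w)| <= M%:R) /\
  exists x, [/\ `|x| <= M%:R, X i0 w + trigpoly s freq (X^~ w) x = 0 &
                jacdet s freq (X^~ w) x = 0]].

(** The centres g of the squares depend on the cell of x and on the cell of the
    coefficients, so they are constants on the event that the coefficients fall in
    that cell, and the independent variable X i0 hits a given square with
    probability O(1/N^4).  There are O(N^2) cells for x and O(N) squares. *)
Lemma degenerate_zero_cover (M : nat) :
  exists C : R, forall N : nat, (0 < N)%N ->
  exists U : set Omega, [/\ measurable U, degenerate_zero M `<=` U &
    (P U <= (C / N%:R)%:E)%E].
Proof.
have A0 : 0 <= 2 * M%:R :> R by rewrite mulr_ge0.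
have [k kP] := critical_values_cover s freq A0.
pose kappa : R := normal_peak 1.
exists ((2 * M%:R + 1) ^+ 2 * (2 * k%:R + 1) * (kappa * (2 * k.+1%:R)) ^+ 2).
move=> N N0; have Np : 0 < N%:R :> R by rewrite ltr0n.
have N2 : 0 < N%:R ^+ 2 :> R by rewrite exprn_gt0.
pose p := (2 * M * N).+1; pose m := (2 * M * N ^ 2).+1.
pose cells := {ffun J -> 'I_m * 'I_m}.
(* Independence speaks of families of boxes indexed by all of K, whereas the
   cells form a finite type only if they are indexed by J. *)
pose idx (B : cells) (i : K) : nat * nat :=
  if insub i is Some t then ((B t).1 : nat, (B t).2 : nat) else (0%N, 0%N).
have idxE (B : cells) (i : K) (iJ : i \in J) :
    idx B i = ((B [` iJ]%fset).1 : nat, (B [` iJ]%fset).2 : nat).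
  by rewrite /idx insubT.
pose S (Q : 'I_p * 'I_p) (B : cells) (a : K -> R[i]) (x : 'rV[R]_2) :=
  [/\ forall i, i \in s -> normc (a i) <= 2 * M%:R,
      forall i, i \in s -> coefbox M (N%:R ^+ 2) (idx B i) (a i),
      gridcell M%:R N%:R Q.1 (x ord0 ord0) &
      gridcell M%:R N%:R Q.2 (x ord0 (lift ord0 ord0))].
have SA Q B a x : S Q B a x -> forall i, i \in s -> normc (a i) <= 2 * M%:R by case.
have Sclose Q B a b x y : S Q B a x -> S Q B b y ->
    `|y - x| <= 1 / N%:R /\
    forall i, i \in s -> normc (b i - a i) <= 2 / N%:R ^+ 2.
  move=> [_ aB x0 x1] [_ bB y0 y1]; split.
    rewrite mul1r; have /orP[H|H] := norm_coord_attained (y - x).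
      by rewrite (le_trans H)// !mxE (gridcell_close Np y0 x0).
    by rewrite (le_trans H)// !mxE (gridcell_close Np y1 x1).
  by move=> i iJ; exact: (coefbox_close N2 (bB i iJ) (aB i iJ)).
have /choice[g gP] (QB : ('I_p * 'I_p) * cells) :=
  kP N (S QB.1 QB.2) N0 (@SA QB.1 QB.2) (@Sclose QB.1 QB.2).
pose r : R := k.+1%:R / N%:R ^+ 2.
pose q : R := (kappa * (2 * r)) ^+ 2.
pose cell (B : cells) : set Omega :=
  \bigcap_(i in [set` J]) (X i @^-1` coefbox M (N%:R ^+ 2) (idx B i)).
pose hit Q B j : set Omega := X i0 @^-1` square (g (Q, B) j) r.
pose U := \bigcup_(t : ('I_p * 'I_p) * 'I_(2 * k * N).+1)
  \bigcup_B (hit t.1 B t.2 `&` cell B).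
have q0 : 0 <= q by exact: sqr_ge0.
have r0 : 0 <= r by rewrite divr_ge0// ltW.
have mhit Q B j : measurable (hit Q B j).
  by rewrite /hit; apply: measurable_funPTI; exact: measurable_square.
have mcell B : measurable (cell B).
  apply: fin_bigcap_measurable; first exact: finite_fset.
  by move=> i _; apply: measurable_funPTI; exact: measurable_coefbox.
have fin_cells : finite_set [set: cells] by exact: finite_finset.
have mW t : measurable (\bigcup_B (hit t.1 B t.2 `&` cell B)).
  by apply: fin_bigcup_measurable => // B _; exact: measurableI.
exists U; split.
- by apply: fin_bigcup_measurable => // ; exact: finite_finset.
- move=> w [aM [x [xM Fx Jx]]].
  have gridx (j : 'I_2) : exists c : 'I_p, gridcell M%:R N%:R c (x ord0 j).
    apply: gridcell_cover; [exact: ltW|by rewrite !natrM|].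
    exact: le_trans (normr_coord_le _ _) xM.
  have [Q1 xQ1] := gridx ord0; have [Q2 xQ2] := gridx (lift ord0 ord0).
  have gridc (z : R) : `|z| <= M%:R ->
      exists c : 'I_m, gridcell M%:R (N%:R ^+ 2) c z.
    by apply: gridcell_cover; [exact: ltW|by rewrite natrM natrX natrM].
  have /choice[B BP] (t : J) : exists b : 'I_m * 'I_m,
      coefbox M (N%:R ^+ 2) (b.1 : nat, b.2 : nat) (X (val t) w).
    have [/gridc[b1 H1] /gridc[b2 H2]] := aM (val t) (valP t).
    by exists (b1, b2).
  have wB i : i \in s -> coefbox M (N%:R ^+ 2) (idx (finfun B) i) (X i w).
    by move=> iJ; rewrite (idxE _ _ iJ) ffunE; exact: BP.
  have SQB : S (Q1, Q2) (finfun B) (X^~ w) x.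
    split=> // i /aM[? ?]; rewrite (le_trans (normc_le _))// mulr_natl mulr2n.
    by rewrite lerD.
  have [j jsq] := gP ((Q1, Q2), finfun B) _ _ SQB Jx.
  exists ((Q1, Q2), j) => //; exists (finfun B) => //; split => //.
  by rewrite /hit /preimage /=; move/eqP: Fx; rewrite addr_eq0 => /eqP ->.
have Wq t : (P (\bigcup_B (hit t.1 B t.2 `&` cell B)) <= q%:E)%E.
  apply: disjoint_mixture_le => // [|B].
    apply/trivIsetP => B B' _ _ BB'; rewrite -subset0 => w [wB wB'].
    move/eqP: BB'; apply; apply/ffunP => i.
    have := coefbox_inj (wB (val i) (valP i)) (wB' (val i) (valP i)).
    rewrite !(idxE _ _ (valP i)) fsetsubE /=.
    move=> [E1 E2]; rewrite [LHS]surjective_pairing [RHS]surjective_pairing.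
    by congr pair; exact: val_inj.
  rewrite /hit /cell (mutually_independent_split X_independent)//.
  + apply: lee_wpmul2r; first exact: measure_ge0.
    by apply: complex_gaussian_square_le => //; exact: X_gaussian.
  + exact: measurable_square.
  + by move=> i _; exact: measurable_coefbox.
apply: (le_trans (union_bound_card q0 mW Wq)); rewrite lee_fin.
rewrite !card_prod !card_ord /p.
have -> : (2 * M%:R + 1) ^+ 2 * (2 * k%:R + 1) *
      (kappa * (2 * k.+1%:R)) ^+ 2 / N%:R =
    (((2 * M + 1) * N) ^ 2 * ((2 * k + 1) * N))%N%:R * q.
  by rewrite /q /r natrM natrX !natrM !natrD; field; rewrite gt_eqF.
apply: ler_wpM2r => //; rewrite ler_nat; apply: leq_mul; last by nia.
rewrite -mulnn; apply: leq_mul; nia.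
Qed.

Lemma negligible_degenerate_zero_bounded M : P.-negligible (degenerate_zero M).
Proof.
have [C CP] := degenerate_zero_cover M.
have /choice[U UP] (N : nat) := CP N.+1 isT.
have mU N : measurable (U N) by have [] := UP N.
have mI : measurable (\bigcap_N U N) by exact: bigcapT_measurable.
exists (\bigcap_N U N); split => //; last first.
  by move=> w wM N _; have [_ + _] := UP N; exact.
apply/eqP; rewrite eq_le measure_ge0 andbT; apply/lee_addgt0Pr => e e0.
rewrite add0e.
pose N := Num.bound (`|C| / e).
have [_ _ PU] := UP N.
apply: (@le_trans _ _ (P (U N))).
  by apply: le_measure; rewrite ?inE//; exact: bigcap_inf.
rewrite (le_trans PU)// lee_fin ler_pdivrMr// mulrC -ler_pdivrMr//.
rewrite (@le_trans _ _ (`|C| / e))//.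
  by rewrite ler_wpM2r ?invr_ge0 ?(ltW e0)// ler_norm.
rewrite ltW// (lt_le_trans (archi_boundP _))// ?ler_nat ?leqnSn//.
by rewrite divr_ge0// ltW.
Qed.

(** Every zero of every realisation is seen by some truncation. *)
Lemma negligible_degenerate_zero :
  P.-negligible [set w | exists x, X i0 w + trigpoly s freq (X^~ w) x = 0 /\
    jacdet s freq (X^~ w) x = 0].
Proof.
apply: (negligibleS _ (negligible_bigcup negligible_degenerate_zero_bounded)).
move=> w [x [Fx Jx]].
pose B : R := `|x| + \sum_(i <- s) normc (X i w).
have B0 : 0 <= B by rewrite addr_ge0// sumr_ge0// => i _; exact: normc_ge0.
exists (Num.bound B) => //; have /ltW BM := archi_boundP B0.
have XB i : i \in s -> normc (X i w) <= (Num.bound B)%:R.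
  move=> iJ; rewrite (le_trans _ BM)// /B (big_rem i)//= addrCA lerDl.
  by rewrite addr_ge0// sumr_ge0// => ? _; exact: normc_ge0.
split.
  by move=> i /XB XiB; rewrite !(le_trans _ XiB)// ?normRe_le ?normIm_le.
exists x; split => //; rewrite (le_trans _ BM)// lerDl sumr_ge0// => i _.
exact: normc_ge0.
Qed.

End degenerate_zeros.

Section rotation.
Context {R : realType} {K : choiceType} (s : {fset K}) (freq : K -> 'rV[R]_2).
Variables (i0 : K) (a : K -> R[i]) (y : 'rV[R]_2).
Hypothesis i0s : i0 \in s.

Local Notation s' := (enum_fset (s `\ i0)%fset).
Local Notation freq' := (fun i => freq i - freq i0).

Lemma trigpoly_rotate : trigpoly (enum_fset s) freq a y =
  cis (phase (freq i0) y) * (a i0 + trigpoly s' freq' a y).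
Proof.
rewrite /trigpoly (big_fsetD1 i0)//= mulrDr mulrC; congr (_ + _).
rewrite mulr_sumr; apply: eq_bigr => i _.
by rewrite mulrCA -cisD phaseBl addrC subrK.
Qed.

(** The derivative of the unimodular factor contributes a multiple of the value of
    the polynomial, which vanishes at a zero. *)
Lemma trigpoly_dcoef_rotate j :
  a i0 + trigpoly s' freq' a y = 0 ->
  trigpoly (enum_fset s) freq (dcoef freq j a) y =
  cis (phase (freq i0) y) * trigpoly s' freq' (dcoef freq' j a) y.
Proof.
move=> F0.
have -> : trigpoly s' freq' (dcoef freq' j a) y =
  trigpoly s' freq' (dcoef freq j a) y -
    (0 +i* freq i0 ord0 j) * trigpoly s' freq' a y.
  rewrite /trigpoly mulr_sumr -sumrB; apply: eq_bigr => i _.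
  rewrite /dcoef !mxE mulrA -mulrBl -mulrBl.
  by congr (_ * _ * _); simpc.
have -> : trigpoly s' freq' a y = - a i0.
  by apply/eqP; rewrite -addr_eq0 addrC F0.
rewrite /trigpoly (big_fsetD1 i0)//= {1}/dcoef mulrN opprK addrC mulrDr.
congr (_ + _); last by rewrite mulrC.
rewrite mulr_sumr; apply: eq_bigr => i _.
by rewrite mulrCA -cisD phaseBl addrC subrK.
Qed.

Lemma degenerate_zero_rotate : trigpoly (enum_fset s) freq a y = 0 ->
  a i0 + trigpoly s' freq' a y = 0 /\
  jacdet (enum_fset s) freq a y = jacdet s' freq' a y.
Proof.
rewrite trigpoly_rotate => /eqP; rewrite mulf_eq0 => /orP[/eqP c0|/eqP F0].
  have := normc_cis (phase (freq i0) y); rewrite c0 normc0 => /eqP.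
  by rewrite eq_sym oner_eq0.
split => //; rewrite /jacdet !trigpoly_dcoef_rotate// cross_mull normc_cis.
by rewrite expr1n mul1r.
Qed.

End rotation.

(** * Discrete subsets of the torus *)

Section discrete_sets.
Context {R : realType}.
Implicit Types (x y h z : 'rV[R]_2).

(** Closed and discrete: every point, of Z or not, has a punctured neighbourhood
    that misses Z. *)
Definition punctured_free (Z : set 'rV[R]_2) := forall y,
  exists2 r : R, 0 < r & forall h, h != 0 -> `|h| < r -> ~ Z (y + h).

Lemma finite_punctured_free_compact (Z A : set 'rV[R]_2) :
  compact A -> punctured_free Z -> finite_set (A `&` Z).
Proof.
move=> cA Zr; have /choice[r rP] (y : 'rV[R]_2) : exists r : R, 0 < r /\
    forall h, h != 0 -> `|h| < r -> ~ Z (y + h).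
  by have [r r0 rZ] := Zr y; exists r.
move: cA; rewrite compact_cover => /(_ _ setT (fun y => ball y (r y))).
case=> [y _|y _|D _ AD].
- by apply: ball_open; have [] := rP y.
- by exists y => //; apply: ballxx; have [] := rP y.
apply: (sub_finite_set _ (finite_fset D)) => z [/AD[y yD yz] Zz] /=.
suff -> : z = y by [].
apply/eqP; apply: contrapT => /negP zy.
have [_ /(_ (z - y))] := rP y; rewrite subr_eq0 [y + _]addrC subrK => /(_ zy).
apply=> //; move: yz; rewrite -ball_normE /ball_ /= distrC.
exact.
Qed.

Definition unit_square : set 'rV[R]_2 :=
  [set y | forall j, `[0, 1]%classic (y ord0 j)].

Lemma torus_lift_unit_square (x : torus R) :
  exists2 y, unit_square y & \pi_(torus R) y = x.
Proof.
exists (\row_j (repr x ord0 j - (Num.floor (repr x ord0 j))%:~R)).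
  move=> j; rewrite mxE /= in_itv /= subr_ge0.
  have /andP[-> /ltW] := floor_itv (repr x ord0 j).
  by rewrite intrD lerBlDl.
rewrite -[RHS]reprK; apply/torusP.
exists (\row_j - Num.floor (repr x ord0 j)); apply/rowP => j.
by rewrite !mxE rmorphN.
Qed.

Variable N : set (torus R).
Hypothesis Nfree : punctured_free (\pi_(torus R) @^-1` N).

Lemma finite_punctured_free_torus : finite_set N.
Proof.
have cI : compact unit_square.
  apply: (@rV_compact R 2 (fun=> `[0, 1]%classic)) => j.
  exact: segment_compact.
have := finite_image (\pi_(torus R)) (finite_punctured_free_compact cI Nfree).
apply: sub_finite_set => x Nx.
have [y yI yx] := torus_lift_unit_square x.
by exists y => //; split => //; rewrite /= yx.
Qed.

(** Removing x from N leaves a closed set in the quotient topology, because each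
    lift of each point of the torus has a punctured ball free of lifts of N. *)
Lemma isolated_punctured_free_torus (x : torus R) : N x -> isolated N x.
Proof.
move=> Nx; split; first exact/mem_set.
exists (~` (N `\ x)).
  apply: open_nbhs_nbhs; split; last by move=> [_]; exact.
  rewrite /open /= /quotient_open openE => z /= Vz.
  have [r r0 rN] := Nfree z.
  apply/nbhs_ballP; exists r => //= w; rewrite -ball_normE /ball_ /= distrC => wz.
  have [->//|wz0] := eqVneq w z.
  move=> [Nw _]; have := rN (w - z).
  by rewrite subr_eq0 [z + _]addrC subrK => /(_ wz0 wz).
apply/seteqP; split => [y /= [H Ny]|_ ->].
  by apply: contrapT => yx; apply: H.
by split => // -[_]; exact.
Qed.

End discrete_sets.

(** * The nodal set of the random wave *)

Lemma det_mx22 (R : comPzRingType) (A : 'M[R]_2) : \det A =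
  A ord0 ord0 * A (lift ord0 ord0) (lift ord0 ord0) -
  A ord0 (lift ord0 ord0) * A (lift ord0 ord0) ord0.
Proof.
rewrite (expand_det_row _ ord0) big_ord_recl big_ord1 /cofactor !det_mx11.
rewrite !mxE /= expr0 expr1 mul1r mulN1r mulrN.
by congr (_ * A _ _ - _ * A _ _); apply: val_inj.
Qed.

Section wave.
Context {R : realType} (n : nat).
Implicit Types (a : 'rV[int]_2 -> R[i]) (y : 'rV[R]_2).

Definition frequencies : {fset 'rV[int]_2} := fset_set (Lambda n).
Definition wave_vector (l : 'rV[int]_2) : 'rV[R]_2 := (2 * pi) *: map_mx intr l.

Local Notation s := (enum_fset frequencies).
Local Notation c := (Num.sqrt (#|` frequencies|%:R : R))^-1%:C.

(** The normalisation is absorbed in the coefficients, which makes the lift of the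
    wave a trigonometric polynomial. *)
Lemma Theta_lift a y : Theta n a (\pi_(torus R) y) =
  trigpoly s wave_vector (fun l => c * a l) y.
Proof.
rewrite /Theta fsbig_finite; last exact: finite_Lambda.
rewrite mulr_sumr; apply: eq_bigr => l _; rewrite e_pi mulrA.
congr (_ * cis _).
rewrite /phase /pairing mulr_sumr; apply: eq_bigr => j _.
by rewrite !mxE mulrA.
Qed.

Lemma det_jacobian_matrix a y :
  \det (jacobian_matrix (ReTheta n a) (ImTheta n a) (\pi_(torus R) y)) =
  jacdet s wave_vector (fun l => c * a l) y.
Proof.
have RT j : partial j (ReTheta n a) (\pi_(torus R) y) =
    complex.Re
      (trigpoly s wave_vector (dcoef wave_vector j (fun l => c * a l)) y).
  rewrite partial_pi -derive_Re_trigpoly; congr ('D_ _ _ _).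
  by apply/funext => z; rewrite /= /ReTheta Theta_lift.
have IT j : partial j (ImTheta n a) (\pi_(torus R) y) =
    complex.Im
      (trigpoly s wave_vector (dcoef wave_vector j (fun l => c * a l)) y).
  rewrite partial_pi -derive_Im_trigpoly; congr ('D_ _ _ _).
  by apply/funext => z; rewrite /= /ImTheta Theta_lift.
by rewrite det_mx22 !mxE /= !RT !IT.
Qed.

Lemma normalization_neq0 l : Lambda n l -> c != 0.
Proof.
move=> nl; rewrite eq_complex negb_and /= invr_eq0 sqrtr_eq0 -ltNge ltr0n.
rewrite cardfs_gt0; apply/orP; left; apply/fset0Pn; exists l.
by rewrite in_fset_set ?inE//; exact: finite_Lambda.
Qed.

End wave.

(** The deterministic half of the theorem, for a realisation a of the coefficients
    without degenerate zero. *)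
Lemma nodal_set_of_nondegenerate (R : realType) (n : nat)
    (a : 'rV[int]_2 -> R[i]) (S := enum_fset (frequencies n))
    (N := (ReTheta n a @^-1` [set 0]) `&` (ImTheta n a @^-1` [set 0])) :
  (exists l, Lambda n l) ->
  (forall y, trigpoly S wave_vector a y = 0 ->
     jacdet S wave_vector a y != 0) ->
  [/\ finite_set N, forall x, N x -> isolated N x,
      N = [set x | Theta n a x = 0] &
      forall x, Theta n a x = 0 -> ~ singular (ReTheta n a) (ImTheta n a) x].
Proof.
move=> [l nl] nd; have c0 := @normalization_neq0 R _ _ nl.
set c := (X in X != 0) in c0.
have NE : N = [set x | Theta n a x = 0].
  apply/seteqP; split => x; rewrite /N /ReTheta /ImTheta /=.
    by case: (Theta n a x) => p q /= [-> ->].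
  by move=> ->.
have ndc y : trigpoly S wave_vector (fun l => c * a l) y = 0 ->
    jacdet S wave_vector (fun l => c * a l) y != 0.
  rewrite trigpoly_scale jacdet_scale => /eqP; rewrite mulf_eq0 (negbTE c0) /=.
  move=> /eqP /nd J0; by rewrite mulf_neq0// expf_neq0// (normc_neq0 c0).
have Nfree : punctured_free (\pi_(torus R) @^-1` N).
  move=> y; have [r r0 rF] := punctured_nonzero (ndc y).
  exists r => // h h0 hr; rewrite NE /= Theta_lift => /eqP.
  by apply/negP; exact: rF.
split => //.
- exact: finite_punctured_free_torus.
- exact: isolated_punctured_free_torus.
move=> x Tx; rewrite /singular unitmxE unitfE -[x]reprK det_jacobian_matrix.
by apply/negP; rewrite negbK ndc// -Theta_lift reprK.
Qed.

Theorem proposition1p6 (R : realType) (d : measure_display)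
    (Omega : measurableType d) (P : probability Omega R)
    (n : nat) (n_in_S : two_square_sums n)
    (v : 'rV[int]_2 -> {RV P >-> R[i]})
    (v_independent :
       mutually_independent P (Lambda n) (fun lambda => v lambda : Omega -> R[i]))
    (v_identically_distributed :
       identically_distributed P (Lambda n) (fun lambda => v lambda : Omega -> R[i]))
    (v_gaussian : forall lambda, Lambda n lambda -> complex_gaussian P (v lambda)) :
  {ae P, forall w : Omega,
    let Th := Theta n (fun lambda => v lambda w) in
    let T := ReTheta n (fun lambda => v lambda w) in
    let That := ImTheta n (fun lambda => v lambda w) in
    let nodal_intersection := (T @^-1` [set 0]) `&` (That @^-1` [set 0]) in
    let I := [set x : torus R | Th x = 0] in
    [/\ finite_set nodal_intersection,
        forall x, nodal_intersection x -> isolated nodal_intersection x,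
        nodal_intersection = I &
        forall x, I x -> ~ singular T That x]}.
Proof.
have [_ [p [q npq]]] := n_in_S.
pose l0 : 'rV[int]_2 := \row_j (if j == ord0 then p else q).
have nl0 : Lambda n l0.
  by rewrite /Lambda /= big_ord_recl big_ord1 !mxE /= npq.
have memL l : (l \in frequencies n) = (l \in Lambda n).
  by rewrite in_fset_set//; exact: finite_Lambda.
have l0F : l0 \in frequencies n by rewrite memL inE.
pose J := (frequencies n `\ l0)%fset.
have JL : [set` J] `<=` Lambda n.
  by move=> l /=; rewrite !inE memL => /andP[_]; rewrite inE.
have l0J : l0 \notin J by rewrite !inE eqxx.
apply: negligibleS (negligible_degenerate_zero v_independent v_gaussian
  (fun l => wave_vector l - wave_vector l0) nl0 JL l0J).
move=> w /= bad; apply: contrapT => good; apply: bad.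
apply: nodal_set_of_nondegenerate; first by exists l0.
move=> y Fy; apply/eqP => Jy; apply: good; exists y.
have [F0 JE] := degenerate_zero_rotate l0F Fy.
by split; [exact: F0|rewrite -Jy JE].
Qed.
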